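(* Let $s>0$ and let $G$ be a finite graph in which every edge has length at least $s$. Let $r=\mathrm{FvsNum}(G)$. Then for any $n\ge1$ agents with arbitrary monotone (continuous, nonnegative) valuations, there exists an $s$-separated allocation $(A_1,\dots,A_n)$ in which each $A_i$ is connected and $v_i(A_i)\ge\mathrm{MMS}_i^{n+r,s}$ for every $i\in[n]$.
   Context: Cake model: the cake is a finite undirected graph $G=(V,E)$, possibly disconnected, in which every edge is a segment of positive length; points of $G$ are its vertices and the points on its edges. A piece of cake is a finite union of intervals contained in edges, together possibly with some vertices. A piece $X$ is connected if any two points of $X$ can be joined by a path in $G$ that stays inside $X$. Each agent $i$ has a valuation $v_i$ on pieces that is nonnegative, monotone and continuous; in particular, points have value $0$. Distances: $\mathrm{Dist}^G(x,y)$ is the length of a shortest path along the edges, and is $\infty$ if $x$ and $y$ lie in different components. For sets, $\mathrm{Dist}^G(X,Y)=\inf_{x\in X,y\in Y}\mathrm{Dist}^G(x,y)$. Separation: a $k$-partition is $s$-separated if it consists of $k$ pairwise disjoint connected pieces $P_1,\dots,P_k$ with $\mathrm{Dist}^G(P_i,P_j)\ge s$ for all $i\ne j$. An $s$-separated allocation is a vector of connected pieces satisfying the same condition. Maximin share: $\mathrm{MMS}_i^{k,s}=\sup\min_{j\in[k]}v_i(P_j)$, where the supremum ranges over $s$-separated $k$-partitions. $\mathrm{FvsNum}(G)$ is the minimum number of vertices whose removal from $G$ leaves an acyclic graph. *)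

(* Defs.v *)
From mathcomp Require Import all_boot.
From Stdlib Require Import Reals Relations.
From Stdlib Require List.

Set Implicit Arguments.
Unset Strict Implicit.
Unset Printing Implicit Defensive.

Local Open Scope R_scope.

(* The cake: a finite undirected (simple) graph with positive edge     *)
(* lengths.  Edge [e] goes from [gsrc e] to [gdst e]; the points of *)
(* the interior of [e] are parametrised by [t] with 0 < t < glen e.   *)
Record mgraph := MGraph {
  gV : finType;
  gE : finType;
  gsrc : gE -> gV;
  gdst : gE -> gV;
  glen : gE -> R }.

Definition wf_graph (G : mgraph) : Prop :=
  (forall e : gE G, 0 < glen e) /\
  (forall e : gE G, gsrc e <> gdst e) /\
  (forall e1 e2 : gE G,
     (gsrc e1 = gsrc e2 /\ gdst e1 = gdst e2) \/
     (gsrc e1 = gdst e2 /\ gdst e1 = gsrc e2) -> e1 = e2).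

Inductive point (G : mgraph) : Type :=
| PV : gV G -> point G
| PE : gE G -> R -> point G.
Arguments PV {G}.
Arguments PE {G}.

Definition pt (G : mgraph) (e : gE G) (t : R) : point G :=
  if Rle_dec t 0 then PV (gsrc e)
  else if Rle_dec (glen e) t then PV (gdst e)
  else PE e t.

Definition pset (G : mgraph) := point G -> Prop.

Record segdesc (G : mgraph) := Seg {
  sg_e : gE G; sg_a : R; sg_b : R; sg_lc : bool; sg_rc : bool }.

Definition seg_set (G : mgraph) (d : segdesc G) : pset G :=
  fun x => exists t, 0 <= t <= glen (sg_e d) /\
    (if sg_lc d then sg_a d <= t else sg_a d < t) /\
    (if sg_rc d then t <= sg_b d else t < sg_b d) /\
    x = pt (sg_e d) t.

Definition union_of (G : mgraph) (ds : list (segdesc G)) (vs : list (gV G))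
  : pset G :=
  fun x => (exists d, List.In d ds /\ seg_set d x) \/
           (exists v, List.In v vs /\ x = PV v).

Definition is_piece (G : mgraph) (X : pset G) : Prop :=
  exists ds vs, forall x, X x <-> union_of ds vs x.

Definition edge_move (G : mgraph) (x y : point G) (e : gE G) (t1 t2 : R) :=
  0 <= t1 <= glen e /\ 0 <= t2 <= glen e /\ pt e t1 = x /\ pt e t2 = y.

Definition step_in (G : mgraph) (X : pset G) (x y : point G) : Prop :=
  exists e t1 t2, edge_move x y e t1 t2 /\
    forall t, Rmin t1 t2 <= t <= Rmax t1 t2 -> X (pt e t).

Definition connected_piece (G : mgraph) (X : pset G) : Prop :=
  forall x y, X x -> X y -> clos_refl_trans (point G) (step_in X) x y.

Inductive walk (G : mgraph) : point G -> point G -> R -> Prop :=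
| walk_nil x : walk x x 0
| walk_cons x y z e t1 t2 l :
    edge_move x y e t1 t2 -> walk y z l -> walk x z (Rabs (t2 - t1) + l).

(* Dist^G(X, Y) >= s, i.e. the infimum over x in X, y in Y of the
   shortest-path distance is >= s (vacuous, i.e. distance infinity, when
   no path exists) *)
Definition dist_ge (G : mgraph) (X Y : pset G) (s : R) : Prop :=
  forall x y l, X x -> Y y -> walk x y l -> s <= l.

Definition s_separated (G : mgraph) (k : nat) (s : R) (P : 'I_k -> pset G)
  : Prop :=
  (forall j, is_piece (P j) /\ connected_piece (P j)) /\
  (forall i j, i <> j ->
     (forall x, P i x -> P j x -> False) /\ dist_ge (P i) (P j) s).

Definition valuation (G : mgraph) (v : pset G -> R) : Prop :=
  (forall X, is_piece X -> 0 <= v X) /\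
  (forall X Y, is_piece X -> is_piece Y -> (forall x, X x -> Y x) ->
     v X <= v Y) /\
  (forall x : point G, is_piece (fun y => y = x) -> v (fun y => y = x) = 0) /\
  (forall ds vs eps, 0 < eps -> exists delta, 0 < delta /\
     forall ds', List.Forall2 (fun d d' => sg_e d' = sg_e d /\ sg_lc d' = sg_lc d /\
                      sg_rc d' = sg_rc d /\ Rabs (sg_a d' - sg_a d) < delta /\
                      Rabs (sg_b d' - sg_b d) < delta) ds ds' ->
       Rabs (v (union_of ds' vs) - v (union_of ds vs)) < eps).

(* x >= MMS^{k,s}(v) = sup over s-separated k-partitions P of min_j v(P_j);
   unfolded: every s-separated k-partition has some part of value <= x. *)
Definition ge_MMS (G : mgraph) (v : pset G -> R) (k : nat) (s : R) (x : R)
  : Prop :=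
  forall P : 'I_k -> pset G, s_separated s P -> exists j, v (P j) <= x.

Definition adjacent (G : mgraph) (u w : gV G) : Prop :=
  exists e : gE G, (gsrc e = u /\ gdst e = w) \/ (gsrc e = w /\ gdst e = u).

Definition cycle_avoiding (G : mgraph) (F : {set gV G}) (c : seq (gV G))
  : Prop :=
  uniq c /\ leq 3 (size c) /\ (forall v, v \in c -> v \notin F) /\
  (forall i, leq i.+1 (size c) ->
     forall x0, adjacent (nth x0 c i) (nth x0 c (modn i.+1 (size c)))).

Definition is_fvs (G : mgraph) (F : {set gV G}) : Prop :=
  forall c, ~ cycle_avoiding F c.

Definition FvsNum_is (G : mgraph) (r : nat) : Prop :=
  (exists F : {set gV G}, is_fvs F /\ #|F| = r) /\
  (forall F : {set gV G}, is_fvs F -> leq r #|F|).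

(* Main.v *)
(* Each agent keeps one part of an optimal partition of her own.  A maximin
   partition into n + r parts exists: connected pieces may be replaced by
   canonical closed ones, described by a finite shape and boundedly many
   bounded reals, so a maximising sequence has a limit.  Let F be a feedback
   vertex set of size r.  At most one part of a partition comes within s/2 of a
   given f in F, so every agent has n parts at distance at least s/2 from F, and
   walks shorter than s between such parts avoid F.  In the rooted forest G - F,
   choose among all remaining parts of all agents one, say A, whose top is
   deepest.  If two parts that reach at least as high as A come within less
   than s of A, they are within less than s of each other; hence A spoils at
   most one part of every other agent, and the choice can be iterated. *)
Require Import Defs.
From mathcomp Require Import all_boot.
From Stdlib Require Import Reals Relations Lra Classical ClassicalEpsilon.

Set Implicit Arguments.
Unset Strict Implicit.
Unset Printing Implicit Defensive.

Local Open Scope R_scope.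

(** * Reals and finite types *)

Definition asbool (P : Prop) : bool := excluded_middle_informative P.

Lemma asboolP (P : Prop) : reflect P (asbool P).
Proof. exact: sumboolP. Qed.

Lemma choice_fun (T U : Type) (R : T -> U -> Prop) :
  (forall t, exists u, R t u) -> exists f, forall t, R t (f t).
Proof.
move=> HR; exists (fun t => proj1_sig (constructive_indefinite_description _ (HR t))).
by move=> t; case: constructive_indefinite_description.
Qed.

(** [a] is the supremum of the lengths of initial segments contained in [Z]. Whether [a] itself lies
    in [Z] is left open, hence the approximation from below; this supplies the closed ends of
    canonical pieces. *)
Lemma initial_segment_sup (Z : R -> Prop) (L : R) : 0 <= L -> Z 0 ->
  exists a, [/\ 0 <= a <= L,
    forall d, 0 <= d <= L -> (forall d', 0 <= d' <= d -> Z d') -> d <= a &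
    forall d eps, 0 < eps -> 0 <= d <= a ->
      exists d', [/\ 0 <= d' <= d, d - d' < eps & Z d']].
Proof.
move=> L0 Z0; pose E d := 0 <= d <= L /\ forall d', 0 <= d' <= d -> Z d'.
have E0 : E 0 by split=> [|d' ?]; [lra|have -> : d' = 0 by lra].
have [||a [ub lub]] := completeness E.
- by exists L => d [? _]; lra.
- by exists 0.
exists a; split; first by split; [apply: ub|apply: lub => d [? _]; lra].
  by move=> d ? ?; apply: ub.
move=> d eps e0 Hd; have [d2 [[H2 HZ] Hlt]] : exists d2, E d2 /\ a - eps < d2.
  apply: NNPP => Hn; suff : a <= a - eps by lra.
  by apply: lub => d2 Ed2; apply: Rnot_lt_le => ?; apply: Hn; exists d2.
exists (Rmin d d2); have ? : Rmin d d2 <= d2 by exact: Rmin_r.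
have [le|le] := Rle_dec d d2.
  by rewrite (Rmin_left _ _ le); split; [lra|lra|apply: HZ; lra].
by rewrite Rmin_right; [split; [lra|lra|apply: HZ; lra]|lra].
Qed.

Lemma inv_INR_lt eps N : 0 < eps -> exists n, leq N n /\
  forall m, leq n m -> / INR m.+1 < eps.
Proof.
move=> e0; have [n [Hn /lt_0_INR n0]] := archimed_cor1 _ e0; exists (maxn N n).
split=> [|m Hm]; first exact: leq_maxl.
apply: Rle_lt_trans Hn; apply: Rinv_le_contravar => //; apply: le_INR; apply/leP.
exact: leqW (leq_trans (leq_maxr _ _) Hm).
Qed.

Lemma INR_close_eq n m : INR n < INR m + 1 -> INR m < INR n + 1 -> n = m.
Proof.
rewrite -!S_INR => /INR_lt/ltP H1 /INR_lt/ltP H2.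
by apply/eqP; rewrite eqn_leq -ltnS H1 -ltnS H2.
Qed.

(** Bolzano-Weierstrass, one coordinate at a time: along indices [phi n >= n] that serve the
    coordinates already treated, the new coordinate has a cluster value. *)
Lemma cluster_point (I : eqType) (t : seq I) (u : nat -> I -> R) (B : I -> R) :
  (forall n i, Rabs (u n i) <= B i) ->
  exists l : I -> R, forall delta N, 0 < delta ->
    exists2 m, leq N m & forall i, i \in t -> Rabs (u m i - l i) < delta.
Proof.
move=> HB; elim: t => [|i0 t [l IH]]; first by exists (fun=> 0) => delta N _; exists N.
pose close n m := leq n m /\ forall i, i \in t -> Rabs (u m i - l i) < / INR n.+1.
have [phi Hphi] : exists phi, forall n, close n (phi n).
  apply: choice_fun => n; have [|m ? ?] := IH (/ INR n.+1) n; last by exists m.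
  by apply: Rinv_0_lt_compat; apply: lt_0_INR; apply/ltP.
have [|l0 Hl0] := Bolzano_Weierstrass (fun n => u (phi n) i0) _ (compact_P3 (- B i0) (B i0)).
  move=> n; have := HB (phi n) i0; have := Rle_abs (u (phi n) i0).
  by have := Rle_abs (- u (phi n) i0); rewrite Rabs_Ropp; lra.
exists (fun i => if i == i0 then l0 else l i) => delta N d0.
have [n [Nn Hn]] := inv_INR_lt N d0.
have [|p [/leP np Hp]] := Hl0 (disc l0 (mkposreal _ d0)) n; first by exists (mkposreal _ d0).
have [pp Hclose] := Hphi p; exists (phi p) => [|i].
  exact: leq_trans Nn (leq_trans np pp).
rewrite inE; have [-> _|_ /= /Hclose] := eqVneq i i0; first exact: Hp.
by move/Rlt_trans; apply; apply: Hn.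
Qed.

Lemma In_mem (T : eqType) (u : T) (t : seq T) : List.In u t <-> u \in t.
Proof.
elim: t => //= u' t IH; rewrite inE; split=> [[->|/IH->]|/orP[/eqP->|/IH]]; rewrite ?eqxx ?orbT //; tauto.
Qed.

Lemma In_map_enum (T : finType) (U : Type) (A : {set T}) (f : T -> U) u :
  List.In u [seq f t | t <- enum A] <-> exists2 t, t \in A & u = f t.
Proof.
rewrite List.in_map_iff; split=> [[t [<- /In_mem]]|[t tA ->]]; first by rewrite mem_enum; exists t.
by exists t; split=> //; apply/In_mem; rewrite mem_enum.
Qed.

(** The witness is the projection of [t] onto the interval from [l'] to [u']. *)
Lemma clamp_close l u l' u' t eps : l' <= u' -> l <= t <= u ->
  Rabs (l' - l) < eps -> Rabs (u' - u) < eps ->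
  exists t', l' <= t' <= u' /\ Rabs (t - t') < eps.
Proof.
move=> lu Ht /Rabs_def2 Hl /Rabs_def2 Hu; exists (Rmax l' (Rmin t u')).
rewrite /Rmax /Rmin; destruct (Rle_dec t u'); destruct (Rle_dec l' _);
  by split; [lra|apply: Rabs_def1; lra].
Qed.

(** * Greedy choice among finitely many items *)

Lemma total_max (T : eqType) (R : T -> T -> Prop) (t : seq T) :
  (forall x y, R x y \/ R y x) -> (forall x y z, R x y -> R y z -> R x z) ->
  t <> [::] -> exists2 x, x \in t & forall y, y \in t -> R y x.
Proof.
move=> Rt Rtr; have Rr x : R x x by case: (Rt x x).
elim: t => // x t IH _; have [->|/IH[y yt Hy]] : t = [::] \/ t <> [::].
- by case: t {IH} => [|? ?]; [left|right].
- by exists x => [|y]; rewrite !inE // => /eqP->.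
have [xy|yx] := Rt x y.
  by exists y => [|z]; rewrite !inE ?yt ?orbT // => /orP[/eqP->|/Hy].
exists x => [|z]; rewrite !inE ?eqxx // => /orP[/eqP->//|/Hy zy]; exact: Rtr yx.
Qed.

(* Serve the agents one by one, each time taking an [R]-maximal remaining pair;
   it conflicts with at most one item of every other agent. *)
Lemma greedy_choice (I K : finType) (R bad : I * K -> I * K -> Prop)
    (ok : I * K -> Prop) (k0 : K) :
  (forall x y, R x y \/ R y x) -> (forall x y z, R x y -> R y z -> R x z) ->
  (forall x y, bad x y -> bad y x) ->
  (forall x i k k', ok x -> ok (i, k) -> ok (i, k') -> R (i, k) x -> R (i, k') x ->
     bad x (i, k) -> bad x (i, k') -> k = k') ->
  forall (S : {set I}) (J : I -> {set K}),
  (forall i, i \in S -> leq #|S| #|J i|) ->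
  (forall i k, i \in S -> k \in J i -> ok (i, k)) ->
  exists c : I -> K, (forall i, i \in S -> c i \in J i) /\
    forall i i', i \in S -> i' \in S -> i <> i' -> ~ bad (i, c i) (i', c i').
Proof.
move=> Rt Rtr bad_sym one S; have [n] := ubnP #|S|.
elim: n S => // n IH S /ltnSE-leSn J HJ Hok.
have [->|/set0Pn[i1 i1S]] := eqVneq S set0.
  by exists (fun=> k0); split=> [i|i i']; rewrite inE.
pose D := [seq x <- enum {: I * K} | (x.1 \in S) && (x.2 \in J x.1)].
have DP i k : ((i, k) \in D) = (i \in S) && (k \in J i).
  by rewrite mem_filter mem_enum inE andbT.
have [|[i0 j0]] := total_max Rt Rtr (t := D).
  have /card_gt0P[j1 j1J] : leq 1 #|J i1|.
    by apply: leq_trans (HJ _ i1S); apply/card_gt0P; exists i1.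
  by move=> E; have := DP i1 j1; rewrite E i1S j1J.
rewrite DP => /andP[iS jJ] Hmax.
pose J' i := [set j in J i | ~~ asbool (bad (i0, j0) (i, j))].
have sub i k : i \in S :\ i0 -> k \in J' i ->
    [/\ i \in S, k \in J i & ~ bad (i0, j0) (i, k)].
  by rewrite !inE => /andP[_ ->] /andP[-> /asboolP].
have [|i iS'|i k|c [cJ cbad]] := IH (S :\ i0) _ J'.
- by apply: leq_trans leSn; rewrite [#|S|](cardsD1 i0) iS.
- have iS2 : i \in S by move: iS'; rewrite !inE => /andP[].
  (* Serving [i0] lowers the demand by one, and by [one] it removes at most one item of [i]. *)
  rewrite -ltnS (leq_trans _ (leq_trans (HJ i iS2) _)) //.
    by rewrite [#|S|](cardsD1 i0) iS.
  rewrite -(cardsID (J' i) (J i)) -addn1 leq_add //.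
    by apply: subset_leq_card; apply: subsetIr.
  apply/card_le1P => k; rewrite !inE => /andP[+ kJ] k'; rewrite kJ negbK => /asboolP bk.
  rewrite !inE; apply/idP/eqP => [/andP[+ k'J]|->]; last first.
    by rewrite kJ /= negbK andbT; apply/asboolP.
  rewrite k'J negbK => /asboolP bk'.
  apply: (one (i0, j0) i) => //; try exact: Hok; by apply: Hmax; rewrite DP iS2.
- by move=> iS' /(sub _ _ iS')[? ? _]; apply: Hok.
exists (fun i => if i == i0 then j0 else c i); split=> [i Si|i i' Si Si' ne].
  have [->//|ni] := eqVneq i i0.
  by have iS' : i \in S :\ i0; [rewrite !inE ni|case: (sub _ _ iS' (cJ _ iS'))].
have out k : k \in S -> k != i0 -> ~ bad (i0, j0) (k, c k).
  move=> Sk nk; have kS' : k \in S :\ i0 by rewrite !inE nk.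
  by case: (sub _ _ kS' (cJ _ kS')).
have [Ei|ni] := eqVneq i i0; have [Ei'|ni'] := eqVneq i' i0.
- by case: ne; rewrite Ei.
- by rewrite Ei; apply: out.
- by move/bad_sym; rewrite Ei'; apply: out.
- by apply: cbad => //; rewrite !inE ?ni ?ni'.
Qed.

(** * Points and walks of the graph *)

Section Graph.

Variable G : mgraph.
Hypothesis wfG : wf_graph G.

Implicit Types (e : gE G) (x y z : point G) (X : pset G) (b : bool).

Let len_gt0 e : 0 < glen e.
Proof. by case: wfG. Qed.

Definition endv e b : gV G := if b then gdst e else gsrc e.

(* The point of [e] at distance [d] from its endpoint [endv e b]. *)
Definition pe e b (d : R) : point G := pt e (if b then glen e - d else d).

Lemma pt_pe e b t : pt e t = pe e b (if b then glen e - t else t).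
Proof. by rewrite /pe; case: b => //; congr pt; ring. Qed.

Lemma pe_flip e b d : pe e b d = pe e (~~ b) (glen e - d).
Proof. by rewrite /pe; case: b => //=; congr pt; ring. Qed.

Lemma pt_mid e t : 0 < t < glen e -> pt e t = PE e t.
Proof.
move=> [t0 tL]; rewrite /pt.
by destruct (Rle_dec t 0); [lra|destruct (Rle_dec (glen e) t); [lra|]].
Qed.

Lemma pe_mid e b d : 0 < d < glen e ->
  pe e b d = PE e (if b then glen e - d else d).
Proof. by move=> Hd; rewrite /pe pt_mid //; case: b; lra. Qed.

Lemma pe0 e b : pe e b 0 = PV (endv e b).
Proof.
have := len_gt0 e; rewrite /pe /pt /endv; case: b => H.
  by destruct (Rle_dec (glen e - 0) 0); [lra|destruct (Rle_dec _ (glen e - 0)); [|lra]].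
by destruct (Rle_dec 0 0); [|lra].
Qed.

Lemma pe_len e b : pe e b (glen e) = PV (endv e (~~ b)).
Proof. by rewrite pe_flip Rminus_diag pe0. Qed.

Lemma endv_inj e b b' : endv e b = endv e b' -> b = b'.
Proof.
case: wfG => _ [/(_ e) H _]; rewrite /endv.
by case: b; case: b' => // E; case: H; rewrite E.
Qed.

Lemma pe_cases e b d : 0 <= d <= glen e ->
  [\/ d = 0, d = glen e | 0 < d < glen e].
Proof.
move=> [d0 dL]; case: (Req_dec d 0) => [->|?]; first by constructor 1.
case: (Req_dec d (glen e)) => [->|?]; first by constructor 2.
by constructor 3; lra.
Qed.

Lemma pe_vertex e b d w : 0 <= d <= glen e -> pe e b d = PV w ->
  (d = 0 /\ w = endv e b) \/ (d = glen e /\ w = endv e (~~ b)).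
Proof.
move=> /(pe_cases b) [->|->|Hd].
- by rewrite pe0 => -[->]; left.
- by rewrite pe_len => -[->]; right.
- by rewrite pe_mid.
Qed.

Lemma pe_interior e b d e' b' d' : 0 < d < glen e -> 0 <= d' <= glen e' ->
  pe e b d = pe e' b' d' -> e' = e /\ (b' = b -> d' = d).
Proof.
move=> Hd /(pe_cases b'); rewrite (pe_mid _ Hd) => -[->|->|Hd'].
- by rewrite pe0.
- by rewrite pe_len.
- by rewrite pe_mid // => -[-> E]; split=> // bb; move: E; rewrite bb; case: b {bb}; lra.
Qed.

Lemma pe_inj e b d d' : 0 <= d <= glen e -> 0 <= d' <= glen e ->
  pe e b d = pe e b d' -> d = d'.
Proof.
have L := len_gt0 e; move=> Hd Hd'; case: (pe_cases b Hd) => [->|->|Hm] E.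
- by case: (pe_vertex Hd' (etrans (esym E) (pe0 e b))) => -[-> //] /endv_inj; case: b {E}.
- by case: (pe_vertex Hd' (etrans (esym E) (pe_len e b))) => -[-> //] /endv_inj; case: b {E}.
- by case: (pe_interior Hm Hd' E) => _ ->.
Qed.

Lemma edge_move_pe e b d1 d2 : 0 <= d1 <= glen e -> 0 <= d2 <= glen e ->
  exists t1 t2, edge_move (pe e b d1) (pe e b d2) e t1 t2 /\
    Rabs (t2 - t1) = Rabs (d2 - d1).
Proof.
move=> H1 H2; case: b.
  exists (glen e - d1), (glen e - d2); split; first by split; [lra|split; [lra|]].
  by rewrite -Rabs_Ropp; congr Rabs; ring.
by exists d1, d2.
Qed.

Lemma walk_trans x y z l l' : walk x y l -> walk y z l' -> walk x z (l + l').
Proof.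
elim=> [{}x|{}x y' z' e t1 t2 {}l Hm _ IH] Hw; first by rewrite Rplus_0_l.
by rewrite Rplus_assoc; apply: (walk_cons Hm); apply: IH.
Qed.

Lemma walk_edge x y e t1 t2 : edge_move x y e t1 t2 -> walk x y (Rabs (t2 - t1)).
Proof. by move=> Hm; rewrite -[Rabs _]Rplus_0_r; apply: (walk_cons Hm); exact: walk_nil. Qed.

Lemma edge_move_sym x y e t1 t2 : edge_move x y e t1 t2 -> edge_move y x e t2 t1.
Proof. by case=> ? [? [? ?]]. Qed.

Lemma walk_sym x y l : walk x y l -> walk y x l.
Proof.
elim=> [{}x|{}x y' z' e t1 t2 {}l Hm _ IH]; first exact: walk_nil.
rewrite Rplus_comm Rabs_minus_sym; apply: walk_trans IH _.
exact: walk_edge (edge_move_sym Hm).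
Qed.

Lemma walk_pe e b d1 d2 : 0 <= d1 <= glen e -> 0 <= d2 <= glen e ->
  walk (pe e b d1) (pe e b d2) (Rabs (d2 - d1)).
Proof.
by move=> H1 H2; have [t1 [t2 [/walk_edge H <-]]] := edge_move_pe b H1 H2.
Qed.

Lemma step_in_pe X e b d1 d2 : 0 <= d1 <= glen e -> 0 <= d2 <= glen e ->
  (forall d, Rmin d1 d2 <= d <= Rmax d1 d2 -> X (pe e b d)) ->
  step_in X (pe e b d1) (pe e b d2).
Proof.
move=> H1 H2 HX; case: b HX => HX.
  exists e, (glen e - d1), (glen e - d2); split; first by split; [lra|split; [lra|]].
  move=> t Ht; rewrite (pt_pe e true); apply: HX; move: Ht.
  by rewrite /Rmin /Rmax; do 2?case: Rle_dec; lra.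
by exists e, d1, d2.
Qed.

Lemma step_in_peE X x y : step_in X x y -> forall b, exists e d1 d2,
  [/\ 0 <= d1 <= glen e, 0 <= d2 <= glen e, x = pe e b d1, y = pe e b d2 &
      forall d, Rmin d1 d2 <= d <= Rmax d1 d2 -> X (pe e b d)].
Proof.
case=> e [t1 [t2 [[H1 [H2 [<- <-]]] HX]]] b; exists e.
exists (if b then glen e - t1 else t1), (if b then glen e - t2 else t2).
split; [by case: b; lra|by case: b; lra|exact: pt_pe|exact: pt_pe|].
move=> d Hd; apply: HX; move: Hd.
by case: b; rewrite /Rmin /Rmax; do 2?case: Rle_dec; lra.
Qed.

Lemma step_in_sym X x y : step_in X x y -> step_in X y x.
Proof.
case=> e [t1 [t2 [/edge_move_sym Hm HX]]]; exists e, t2, t1; split=> // t Ht.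
by apply: HX; rewrite Rmin_comm Rmax_comm.
Qed.

Lemma chain_sym X x y :
  clos_refl_trans _ (step_in X) x y -> clos_refl_trans _ (step_in X) y x.
Proof.
elim=> [{}x {}y /step_in_sym|{}x|{}x {}y z _ H1 _ H2]; first exact: rt_step.
- exact: rt_refl.
- exact: rt_trans H2 H1.
Qed.

(** * Rooting the complement of a feedback vertex set *)

Definition adjb (u w : gV G) :=
  [exists e, [exists b, (endv e b == u) && (endv e (~~ b) == w)]].

Lemma adjbP u w : reflect (adjacent u w) (adjb u w).
Proof.
rewrite /adjb; apply: (iffP existsP) => [[e /existsP[b /andP[/eqP<- /eqP<-]]]|[e H]]; exists e.
  by case: b; [right|left].
by apply/existsP; case: H => -[<- <-]; [exists false|exists true]; rewrite !eqxx.
Qed.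

Lemma adjb_sym u w : adjb u w = adjb w u.
Proof. by apply/adjbP/adjbP => -[e [H|H]]; exists e; [right|left|right|left]. Qed.

Lemma adjb_irr u : adjb u u = false.
Proof.
apply/negbTE/negP => /existsP[e /existsP[b /andP[/eqP H1 /eqP H2]]].
have : endv e b = endv e (~~ b) by rewrite H1 H2.
by move/endv_inj; case: b {H1 H2}.
Qed.

Lemma path_cycle_avoiding (F : {set gV G}) (x : gV G) (p : seq (gV G)) :
  path adjb x p -> uniq (x :: p) -> leq 2 (size p) ->
  (forall v, v \in x :: p -> v \notin F) -> adjb (last x p) x ->
  cycle_avoiding F (x :: p).
Proof.
move=> Hp Hu Hs HF Hl; split=> //; split=> //; split=> // i Hi x0.
apply/adjbP; move: Hi; rewrite [size _]/= ltnS leq_eqVlt => /orP[/eqP->|Hi].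
  by rewrite modnn nth_last.
by rewrite modn_small //; apply: (pathP x0 Hp).
Qed.

(* The end of a longest path in [S] cannot have two neighbours in [S]. *)
Lemma fvs_leaf (F S : {set gV G}) : is_fvs F ->
  (forall w, w \in S -> w \notin F) -> S != set0 ->
  exists2 w, w \in S & forall u1 u2, u1 \in S -> u2 \in S ->
    adjb w u1 -> adjb w u2 -> u1 = u2.
Proof.
move=> HF HS /set0Pn[w0 Hw0]; apply: NNPP => Hno.
have two w : w \in S -> exists u1 u2,
    [/\ u1 \in S, u2 \in S, adjb w u1, adjb w u2 & u1 <> u2].
  move=> Hw; apply: NNPP => Hn; apply: Hno; exists w => // u1 u2 *.
  by apply: NNPP => ?; apply: Hn; exists u1, u2.
(* Simple paths in [S] of every length, grown at the head [x]; length [#|gV G|] is then absurd. *)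
have long n : exists (x : gV G) p, [/\ size p = n, path adjb x p, uniq (x :: p) & all (mem S) (x :: p)].
  elim: n => [|n [x [p [Hs Hp Hu Ha]]]].
    by exists w0, [::]; split=> //=; rewrite Hw0.
  have ext u : u \in S -> adjb x u -> u \notin x :: p ->
      exists (x : gV G) p, [/\ size p = n.+1, path adjb x p, uniq (x :: p) & all (mem S) (x :: p)].
    move=> uS xu up; exists u, (x :: p); split; first by rewrite /= Hs.
    - by rewrite /= adjb_sym xu Hp.
    - by rewrite cons_uniq up Hu.
    - by rewrite /= uS; move: Ha => /= ->.
  have xS : x \in S by case/andP: Ha.
  have [u1 [u2 [S1 S2 A1 A2 Hne]]] := two x xS.
  case: (boolP (u1 \in x :: p)) => [m1|]; last exact: ext.
  case: (boolP (u2 \in x :: p)) => [m2|]; last exact: ext.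
  have neq u : adjb x u -> u != x by apply: contraTneq => ->; rewrite adjb_irr.
  (* Only one of the two neighbours can be the vertex right after [x]; the other one closes a cycle
     with at least three vertices. *)
  have [u [uS xu up]] : exists u, [/\ u \in S, adjb x u & u \in behead p].
    move: m1 m2; rewrite !inE (negPf (neq _ A1)) (negPf (neq _ A2)) /=.
    case: (p) => // y q; rewrite !inE => /orP[/eqP E1|?]; last by exists u1.
    case/orP=> [/eqP E2|?]; last by exists u2.
    by case: Hne; rewrite E1 E2.
  case: p => // y q in ext Hs Hp Hu Ha m1 m2 up *.
  rewrite /= in up; case/splitPr: up Hs Hp Hu Ha {m1 m2} => q1 q2 _ Hp Hu Ha.
  have E : x :: y :: q1 ++ u :: q2 = (x :: rcons (y :: q1) u) ++ q2.
    by rewrite /= cat_rcons.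
  case: (HF (x :: rcons (y :: q1) u)); apply: path_cycle_avoiding.
  - by move: Hp; rewrite -cat_cons -cat_rcons cat_path => /andP[].
  - by move: Hu; rewrite E cat_uniq => /andP[].
  - by rewrite size_rcons.
  - by move: Ha; rewrite E all_cat => /andP[/allP Ha _] v /Ha /HS.
  - by rewrite last_rcons adjb_sym.
have [x [p [Hs _ Hu _]]] := long #|gV G|.
by have := max_card (mem (x :: p)); rewrite (card_uniqP Hu) /= Hs ltnn.
Qed.

Lemma simple_edge e e' b b' : endv e b = endv e' b' ->
  endv e (~~ b) = endv e' (~~ b') -> e = e'.
Proof.
case: wfG => _ [_ H]; rewrite /endv.
by case: b; case: b' => /= H1 H2; apply: H; [left|right|right|left].
Qed.

(* [o e] tells which end of [e] is nearer to the root; every vertex of [S]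
   is the lower end of at most one edge, the edge to its parent. *)
Definition rooted (S : {set gV G}) (o : gE G -> bool) (H : gV G -> R) :=
  (forall e, endv e (~~ o e) \in S ->
     endv e (o e) \in S /\ H (endv e (~~ o e)) = H (endv e (o e)) + glen e) /\
  (forall e e', endv e (~~ o e) \in S ->
     endv e (~~ o e) = endv e' (~~ o e') -> e = e').

(** Induction on [#|S|]: take out a leaf [w], root the rest, and hang [w] below its only
    neighbour. *)
Lemma fvs_rooted (F S : {set gV G}) : is_fvs F ->
  (forall w, w \in S -> w \notin F) -> exists o H, rooted S o H.
Proof.
move=> HF; have [n] := ubnP #|S|; elim: n S => // n IH S /ltnSE-leSn HS.
have [->|S0] := eqVneq S set0.
  by exists (fun=> false), (fun=> 0); split=> e; rewrite ?inE // => e'; rewrite inE.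
have [w wS leaf] := fvs_leaf HF HS S0; set S' := S :\ w.
have S'P u : u \in S' -> u \in S /\ u != w by rewrite !inE => /andP[].
have [||o' [H' [IH1 IH2]]] := IH S'.
- by apply: leq_trans leSn; rewrite [#|S|](cardsD1 w) wS.
- by move=> u /S'P[/HS].
(* An edge at [w] has [w] as its lower end exactly when its other end is in [S']. Otherwise its
   lower end is outside [S], where [rooted] asks nothing. *)
pose o e := if [pick b | endv e b == w] is Some b
  then (if endv e (~~ b) \in S' then ~~ b else b) else o' e.
have low_w e : endv e (~~ o e) = w -> endv e (o e) \in S'.
  rewrite /o; case: pickP => [b /eqP Hb|Hn].
    by case: ifP => // _ Eb; have := endv_inj (etrans Hb (esym Eb)); case: b {Hb Eb}.
  by move=> Hl; have := Hn (~~ o' e); rewrite Hl eqxx.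
have low_S' e : endv e (~~ o e) \in S' -> o e = o' e.
  rewrite /o; case: pickP => [b /eqP Hb|//].
  by case: ifP => [_|-> //]; rewrite negbK Hb !inE eqxx.
have low_uniq e e' : endv e (~~ o e) = w -> endv e' (~~ o e') = w -> e = e'.
  have adj f : endv f (~~ o f) = w -> adjb w (endv f (o f)).
    move=> Hf; apply/existsP; exists f; apply/existsP; exists (~~ o f).
    by rewrite Hf negbK !eqxx.
  move=> He He'; apply: (@simple_edge e e' (o e) (o e')); last by rewrite He He'.
  by apply: leaf; rewrite ?adj //; [case: (S'P _ (low_w _ He))|case: (S'P _ (low_w _ He'))].
(* The value 0 serves a [w] without neighbours in [S], which becomes a root. *)
pose H u := if u == w then
  (if [pick e | endv e (~~ o e) == w] is Some e then H' (endv e (o e)) + glen e else 0)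
  else H' u.
have HS' u : u \in S' -> H u = H' u by rewrite /H => /S'P[_ /negPf->].
have inS u : u \in S -> u = w \/ u \in S'.
  by move=> uS; have [|uw] := eqVneq u w; [left|right; rewrite !inE uw].
exists o, H; split=> [e|e e'] /inS[Hl|Hl].
- have Hu := low_w _ Hl; split; first by case: (S'P _ Hu).
  rewrite (HS' _ Hu) Hl {1}/H eqxx; case: pickP => [e2 /eqP He2|Hn].
    by rewrite (low_uniq e2 e He2 Hl).
  by have := Hn e; rewrite Hl eqxx.
- have oe := low_S' e Hl; rewrite oe in Hl *; have [Hu E] := IH1 e Hl.
  by rewrite (HS' _ Hl) (HS' _ Hu); split=> //; case: (S'P _ Hu).
- by rewrite Hl => /esym; apply: low_uniq.
- move=> E; have Hl' := Hl; rewrite E in Hl'.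
  have oe := low_S' e Hl; have oe' := low_S' e' Hl'.
  by rewrite oe oe' in Hl E; apply: IH2 E.
Qed.

(** * Distances in the rooted forest *)

Section Forest.

Variables (F : {set gV G}) (o : gE G -> bool) (H : gV G -> R).
Hypothesis root : rooted (~: F) o H.

Definition avoids x := forall f, f \in F -> x <> PV f.

(** Measured from the upper end of [e], so that [k] grows with the depth. *)
Definition kp e k := pe e (o e) k.

(* Every move goes towards the root.  Vertices of [F] are never left, so that
   they act as leaves that are not glued together. *)
Definition up_step x y := avoids x /\ exists e k1 k2,
  0 <= k2 <= k1 /\ k1 <= glen e /\ x = kp e k1 /\ y = kp e k2.

Definition above := clos_refl_trans _ up_step.

Definition height x := match x with
  | PV w => H w
  | PE e t => H (endv e (o e)) + (if o e then glen e - t else t)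
  end.

(** The side condition excludes a lower end of [e] in [F], where [H] need not agree with the length
    of [e]. *)
Lemma height_kp e k : 0 <= k <= glen e -> (k < glen e \/ avoids (kp e k)) ->
  height (kp e k) = H (endv e (o e)) + k.
Proof.
have L := len_gt0 e; move=> /(pe_cases (o e)) [->|->|Hk] Hav; rewrite /kp.
- by rewrite pe0 /=; ring.
- case: Hav => [|Hav]; first lra.
  rewrite pe_len /=; apply: (proj2 (proj1 root e _)).
  by rewrite inE; apply/negP => fF; apply: (Hav _ fF); apply: pe_len.
- by rewrite (pe_mid _ Hk) /=; case: (o e); ring.
Qed.

Lemma avoids_kp e k1 k2 : 0 < k2 <= k1 -> k1 <= glen e ->
  avoids (kp e k1) -> avoids (kp e k2).
Proof.
move=> H2 H1; case: (Req_dec k2 k1) => [-> //|Hne _ f _].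
by rewrite /kp pe_mid //; lra.
Qed.

Lemma up_stepE x y : up_step x y -> exists e k1 k2,
  [/\ 0 <= k2 <= k1, k1 <= glen e, x = kp e k1, y = kp e k2 &
      height x = H (endv e (o e)) + k1 /\ height y = H (endv e (o e)) + k2].
Proof.
move=> [Hx [e [k1 [k2 [H2 [H1 [Ex Ey]]]]]]]; exists e, k1, k2; split=> //.
rewrite Ex Ey in Hx *; split; apply: height_kp; try lra; first by right.
case: (Req_dec k2 (glen e)) => ?; last by left; lra.
by right; have -> : k2 = k1 by lra.
Qed.

Lemma above_height x y : above x y -> height y <= height x.
Proof.
elim=> [{}x {}y /up_stepE[e [k1 [k2 [? ? _ _ [-> ->]]]]]|{}x|{}x {}y z _ ? _ ?]; lra.
Qed.

Lemma above_walk x y : above x y -> walk x y (height x - height y).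
Proof.
elim=> [{}x {}y|{}x|{}x {}y z _ H1 _ H2].
- move=> /up_stepE[e [k1 [k2 [H2 H1 -> -> [-> ->]]]]].
  have -> : H (endv e (o e)) + k1 - (H (endv e (o e)) + k2) = Rabs (k2 - k1).
    by rewrite Rabs_left1; lra.
  by apply: walk_pe; lra.
- by rewrite Rminus_diag; apply: walk_nil.
- have -> : height x - height z = height x - height y + (height y - height z) by ring.
  exact: walk_trans H1 H2.
Qed.

Lemma above_eq x y : above x y -> height x = height y -> x = y.
Proof.
elim=> [{}x {}y Hxy E| //|{}x {}y z H1 IH1 H2 IH2 E].
  case/up_stepE: Hxy => e [k1 [k2 [_ _ Ex Ey [E1 E2]]]].
  by rewrite Ex Ey; have -> : k1 = k2 by lra.
have ? := above_height H1; have ? := above_height H2.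
by transitivity y; [apply: IH1; lra|apply: IH2; lra].
Qed.

Lemma above_trans x y z : above x y -> above y z -> above x z.
Proof. exact: rt_trans. Qed.

(** A point off [F] has only one edge leading up: an interior point determines its edge, and a
    vertex off [F] is the lower end of at most one. Moves that start at an upper end have length 0
    and are treated first. *)
Lemma up_step_comparable x y z : up_step x y -> up_step x z ->
  clos_refl _ up_step y z \/ clos_refl _ up_step z y.
Proof.
move=> [Hx [e [k1 [k2 [H2 [H1 [Ex Ey]]]]]]] [_ [e' [k1' [k3 [H3 [H1' [Ex' Ez]]]]]]].
have triv k : k = 0 -> 0 <= k3 <= k -> x = kp e' k -> clos_refl _ up_step z y.
  move=> -> Hk E; have -> : z = x by rewrite Ez E; have -> : k3 = 0 by lra.
  by apply: r_step; split=> //; exists e, k1, k2.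
have [k1'0|k1'0] := Req_dec k1' 0; first by right; apply: triv H3 Ex'.
have [k10|k10] := Req_dec k1 0.
  left; have -> : y = x by rewrite Ex Ey; have -> : k2 = k1 by lra.
  by apply: r_step; split=> //; exists e', k1', k3.
have [ee kk] : e' = e /\ k1' = k1.
  have [kL|kL] := Req_dec k1 (glen e).
    have E : endv e (~~ o e) = endv e' (~~ o e').
      move: Ex'; rewrite Ex /kp kL pe_len => /esym/pe_vertex[||[_ ->] //]; first lra.
      by case.
    have Ee : e = e'.
      apply: (proj2 root) E; rewrite inE; apply/negP => /Hx; apply.
      by rewrite Ex /kp kL pe_len.
    subst e'; split=> //; apply: (@pe_inj e (o e)); try lra.
    by rewrite -[RHS]Ex -[LHS]Ex'.
  have Hm : 0 < k1 < glen e by lra.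
  have Hk' : 0 <= k1' <= glen e' by lra.
  have [Ee Hk] := pe_interior Hm Hk' (etrans (esym Ex) Ex').
  by subst e'; split=> //; apply: Hk.
subst e' k1'; have aux k l w w' : w = kp e k -> w' = kp e l ->
    0 <= l <= k -> k <= k1 -> clos_refl _ up_step w w'.
  move=> -> -> Hl Hk; have [k0|k0] := Req_dec k 0.
    by have -> : l = k by [lra]; apply: r_refl.
  apply: r_step; split; last by exists e, k, l; split=> //; split=> //; lra.
  by apply: (@avoids_kp e k1) => //; [lra|rewrite -Ex].
have [le|le] := Rle_dec k2 k3; first by right; apply: aux Ez Ey _ _; lra.
by left; apply: aux Ey Ez _ _; lra.
Qed.

(** The ancestors of a point form a chain: comparability of single moves is pushed along one ascent,
    then along the other. *)
Lemma above_comparable x y z : above x y -> above x z -> above y z \/ above z y.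
Proof.
have toR u w : clos_refl _ up_step u w -> above u w.
  by case=> [? ?|]; [apply: rt_step|apply: rt_refl].
have step u w t : up_step u w -> above u t -> above w t \/ above t w.
  move=> Huw Hut; have {}Hut := clos_rt_rt1n _ _ _ _ Hut; elim: Hut w Huw => [{}u w|{}u u1 {}t H1 H2 IH w] Huw.
    by right; apply: rt_step.
  have {}H2 := clos_rt1n_rt _ _ _ _ H2.
  have [/toR Hw|Hw] := up_step_comparable Huw H1; first by left; apply: above_trans Hw H2.
  by case: Hw => [w' Hs|]; [apply: IH|left].
move=> Hxy; have {}Hxy := clos_rt_rt1n _ _ _ _ Hxy; elim: Hxy z => [{}x z|{}x x1 {}y H1 H2 IH z] Hz; first by left.
have [Hc|Hc] := step _ _ _ H1 Hz; first exact: IH.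
by right; apply: above_trans Hc (clos_rt1n_rt _ _ _ _ H2).
Qed.

Lemma above_le x y z : above x y -> above x z -> height z <= height y -> above y z.
Proof.
move=> Hy Hz Hle; have [//|Hc] := above_comparable Hy Hz.
have := above_height Hc => ?; rewrite (above_eq Hc); [exact: rt_refl|lra].
Qed.

Lemma edge_up_step e d1 d2 : 0 <= d1 <= glen e -> 0 <= d2 <= glen e ->
  avoids (kp e d1) -> avoids (kp e d2) ->
  (up_step (kp e d1) (kp e d2) /\
     Rabs (d2 - d1) = height (kp e d1) - height (kp e d2)) \/
  (up_step (kp e d2) (kp e d1) /\
     Rabs (d2 - d1) = height (kp e d2) - height (kp e d1)).
Proof.
move=> H1 H2 A1 A2; rewrite !height_kp; [|lra|by right|lra|by right].
have [le|le] := Rle_dec d2 d1; [left|right]; (split; last first).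
- by rewrite Rabs_left1; lra.
- by split=> //; exists e, d1, d2; do ![split=> //]; lra.
- by rewrite Rabs_right; lra.
- by split=> //; exists e, d2, d1; do ![split=> //]; lra.
Qed.

(* [height x + height y - 2 * height u] is the length of the tree path from
   [x] up to the common ancestor [u] and down to [y]. *)
Lemma walk_common x y l : walk x y l -> avoids x -> avoids y ->
  (exists u, [/\ above x u, above y u & height x + height y - 2 * height u <= l]) \/
  (exists f l1 l2, [/\ f \in F, walk x (PV f) l1, walk (PV f) y l2 & l = l1 + l2]).
Proof.
elim=> [{}x|{}x x1 {}y e t1 t2 {}l Hm Hw IH] Ax Ay.
  by left; exists x; split; [apply: rt_refl|apply: rt_refl|lra].
have [[f [fF Ef]]|A1] : (exists f, f \in F /\ x1 = PV f) \/ avoids x1.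
  by apply: NNPP => Hn; apply: (Hn); right => f fF Ef; apply: (Hn); left; exists f.
  right; exists f, (Rabs (t2 - t1)), l; rewrite -Ef; split=> //.
  exact: walk_edge Hm.
have [[u [U1 U2 Hl]]|[f [l1 [l2 [fF W1 W2 ->]]]]] := IH A1 Ay; last first.
  right; exists f, (Rabs (t2 - t1) + l1), l2; split=> //; last by ring.
  exact: walk_cons Hm W1.
left; case: Hm => H1 [H2 [Ex Ex1]].
pose d1 := if o e then glen e - t1 else t1; pose d2 := if o e then glen e - t2 else t2.
have [Hd1 Hd2] : 0 <= d1 <= glen e /\ 0 <= d2 <= glen e by rewrite /d1 /d2; case: (o e); lra.
have E : Rabs (t2 - t1) = Rabs (d2 - d1).
  by rewrite /d1 /d2; case: (o e) => //; rewrite -Rabs_Ropp; congr Rabs; ring.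
have {}Ex : kp e d1 = x by rewrite -Ex (pt_pe e (o e)).
have {}Ex1 : kp e d2 = x1 by rewrite -Ex1 (pt_pe e (o e)).
clearbody d1 d2; rewrite -Ex -Ex1 in Ax A1 U1 Hl *; rewrite {}E.
(* A first move up prolongs the ascent to [u]. After a first move down, either [u] is still an
   ancestor of [x], or [x] lies on the ascent to [u] and is itself a common ancestor. *)
have [[Hs ->]|[Hs ->]] := edge_up_step Hd1 Hd2 Ax A1; have {}Hs := rt_step _ _ _ _ Hs.
  by exists u; split=> //; [exact: above_trans Hs U1|lra].
have [Hc|Hc] := above_comparable Hs U1; have := above_height Hc; have := above_height Hs; have := above_height U1 => ? ? ?.
  by exists u; split=> //; lra.
exists (kp e d1); split; [exact: rt_refl|exact: above_trans U2 Hc|lra].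
Qed.

(** The height of [y] dictates [k]; two ancestors of one point at the same height coincide. *)
Lemma above_between e k1 k2 y : 0 <= k2 <= k1 -> k1 <= glen e ->
  up_step (kp e k1) (kp e k2) -> above (kp e k1) y -> above y (kp e k2) ->
  exists2 k, k2 <= k <= k1 & y = kp e k.
Proof.
move=> H2 H1 Hs Hy Hy2; have Ax := proj1 Hs.
have A2 : k2 < glen e \/ avoids (kp e k2).
  by have [?|?] := Req_dec k2 k1; [right; have -> : k2 = k1 by []|left; lra].
have [E1 E2] : height (kp e k1) = H (endv e (o e)) + k1 /\
    height (kp e k2) = H (endv e (o e)) + k2.
  by split; apply: height_kp; [lra|right|lra|].
have ? := above_height Hy; have ? := above_height Hy2.
pose k := height y - H (endv e (o e)).
have [Hk1 Hk2] : k2 <= k /\ k <= k1 by rewrite /k; lra.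
have Hk : up_step (kp e k1) (kp e k).
  by split=> //; exists e, k1, k; do ![split=> //]; lra.
have Ek : height (kp e k) = H (endv e (o e)) + k.
  apply: height_kp; first lra.
  by have [->|?] := Req_dec k k1; [right|left; lra].
exists k => //; have E : height y = height (kp e k) by rewrite Ek /k; ring.
have {}Hk := rt_step _ _ _ _ Hk.
by apply: above_eq (E); apply: above_le Hy Hk _; rewrite E; apply: Rle_refl.
Qed.

(** In a forest a connected set contains the direct path between two of its points; the half from
    [x] up to the common ancestor is what is needed later. The case split is that of
    [walk_common]. *)
Lemma chain_common X x y : (forall z, X z -> avoids z) ->
  clos_refl_trans _ (step_in X) x y -> X x ->
  exists u, [/\ above x u, above y u & forall z, above x z -> above z u -> X z].
Proof.
move=> HX Hxy; have {}Hxy := clos_rt_rt1n _ _ _ _ Hxy.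
have refl_case w z : X w -> above w z -> above z w -> X z.
  move=> Xw Hwz Hzw; have ? := above_height Hwz; have ? := above_height Hzw.
  by rewrite -(above_eq Hwz) //; lra.
elim: Hxy => [{}x Xx|{}x x1 {}y Hs _ IH _].
  by exists x; split; [exact: rt_refl|exact: rt_refl|move=> z; apply: refl_case].
have [e [t1 [t2 [[H1 [H2 [Ex Ex1]]] Hin]]]] := Hs.
pose d t := if o e then glen e - t else t.
have dE t : pt e t = kp e (d t) by exact: pt_pe.
have Hd t : 0 <= t <= glen e -> 0 <= d t <= glen e by rewrite /d; case: (o e); lra.
have dd t : d (d t) = t by rewrite /d; case: (o e); ring.
have Hin' k : d t1 <= k <= d t2 \/ d t2 <= k <= d t1 -> X (kp e k).
  move=> Hk; rewrite -[k]dd -dE; apply: Hin; move: Hk.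
  by rewrite /d /Rmin /Rmax; case: (o e); destruct (Rle_dec t1 t2); lra.
have D1 := Hd _ H1; have D2 := Hd _ H2; rewrite !dE in Ex Ex1.
move: (d t1) (d t2) D1 D2 Ex Ex1 Hin' => d1 d2 D1 D2 Ex Ex1 {}Hin {d dE Hd dd}.
have X1 : X x by rewrite -Ex; apply: Hin; lra.
have X2 : X x1 by rewrite -Ex1; apply: Hin; lra.
have [u [U1 U2 HU]] := IH X2.
have Ax := HX _ X1; have Ax1 := HX _ X2; rewrite -Ex in Ax; rewrite -Ex1 in Ax1.
have [[Hst _]|[Hst _]] := edge_up_step D1 D2 Ax Ax1; have Hab := rt_step _ _ _ _ Hst.
  rewrite Ex Ex1 in Hab; exists u; split=> //; first exact: above_trans Hab U1.
  move=> z Hxz Hzu; have [Hc|Hc] := above_comparable Hab Hxz; first exact: HU.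
  rewrite -Ex1 in Hc; rewrite -Ex in Hxz.
  have Hle : d2 <= d1.
    case/up_stepE: (Hst) => e' [k1 [k2 [_ _ _ _ [E1 E2]]]].
    have ? := above_height (rt_step _ _ _ _ Hst).
    by move: (height_kp D1 (or_intror Ax)) (height_kp D2 (or_intror Ax1)); lra.
  have [k Hk ->] := above_between (conj (proj1 D2) Hle) (proj2 D1) Hst Hxz Hc.
  by apply: Hin; lra.
rewrite Ex Ex1 in Hab.
have [Hc|Hc] := above_comparable Hab U1.
  by exists u; split=> // z Hxz Hzu; apply: HU => //; apply: above_trans Hab Hxz.
exists x; split; [exact: rt_refl|exact: above_trans U2 Hc|].
by move=> z; apply: refl_case.
Qed.

(* [w] plays the part of the top of a set containing [a]; [p] can be moved
   inside [P] to a point [p'] that is no deeper than [w]. *)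
Lemma near_top (P : pset G) a w u p p0 l : (forall z, P z -> avoids z) ->
  connected_piece P -> P p -> P p0 -> height p0 <= height w ->
  above a w -> above a u -> above p u -> height a + height p - 2 * height u <= l ->
  exists p' m, [/\ P p', above p' m, above w m, height p' <= height w &
    height p' + height w - 2 * height m <= l].
Proof.
move=> HP conP Pp Pp0 Hp0 Haw Hau Hpu Hl.
have [c [Hpc Hp0c Pc]] := chain_common HP (conP p p0 Pp Pp0) Pp.
have ? := above_height Hp0c; have ? := above_height Hpc.
have ? := above_height Hau; have ? := above_height Hpu; have ? := above_height Haw.
have cP : P c by apply: Pc => //; apply: rt_refl.
(* The ascent from [p] stays in [P] as far as [c], which is no deeper than [w]. If [u] is not above
   [w], this ascent passes through [w], which serves as [p']. Otherwise [p'] is the deeper of [c]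
   and [u], and the paths meet at [u]. *)
have [le|le] := Rle_dec (height w) (height u).
  have Huw : above u w by apply: above_le Hau Haw le.
  have Hpw : above p w by apply: above_trans Hpu Huw.
  exists w, w; split; [|exact: rt_refl|exact: rt_refl|lra|lra].
  by apply: Pc => //; apply: above_le Hpw Hpc _; lra.
have Hwu : above w u by apply: above_le Haw Hau _; lra.
have [le'|le'] := Rle_dec (height u) (height c).
  by exists c, u; split=> //; [exact: above_le Hpc Hpu le'|lra|lra].
exists u, u; split=> //; [|exact: rt_refl|lra|lra].
by apply: Pc => //; apply: above_le Hpu Hpc _; lra.
Qed.

(** Let [w] in [A] be a common ancestor of [a] and [a']. [near_top] gives [p'] and [q'], no deeper
    than [w], whose paths to [w] turn at ancestors [m] and [m'] of [w]. The path from [p'] to [q']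
    through the higher of these is no longer than one of the two paths to [w], hence shorter than
    [s]. *)
Lemma at_most_one_near (A P Q : pset G) s a a' p q l l' : 0 < s ->
  (forall x f l, A x \/ P x \/ Q x -> f \in F -> walk x (PV f) l -> s / 2 <= l) ->
  connected_piece A -> connected_piece P -> connected_piece Q ->
  (forall x, A x -> exists2 y, P y & height y <= height x) ->
  (forall x, A x -> exists2 y, Q y & height y <= height x) ->
  A a -> A a' -> P p -> Q q -> walk a p l -> walk a' q l' -> l < s -> l' < s ->
  ~ dist_ge P Q s.
Proof.
move=> s0 far conA conP conQ HP HQ Aa Aa' Pp Qq Wl Wl' ls ls' PQ.
have av x : A x \/ P x \/ Q x -> avoids x.
  move=> Hx f fF E; rewrite {}E in Hx.
  by have := far _ _ _ Hx fF (@walk_nil _ _); lra.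
have [avA avP avQ] : [/\ (forall x, A x -> avoids x), (forall x, P x -> avoids x) &
    (forall x, Q x -> avoids x)] by split=> x ?; apply: av; tauto.
(* A walk through [F] would cost at least [s / 2] on either side. *)
have common x y m : A x -> P y \/ Q y -> walk x y m -> m < s ->
    exists u, [/\ above x u, above y u & height x + height y - 2 * height u <= m].
  move=> Ax Py W ms; have [||//|[f [l1 [l2 [fF W1 W2 E]]]]] := walk_common W.
  - by apply: av; left.
  - by apply: av; right.
  have := far x f l1 (or_introl Ax) fF W1; have := far y f l2 (or_intror Py) fF (walk_sym W2); lra.
have [u [U1 U2 Hu]] := common _ _ _ Aa (or_introl Pp) Wl ls.
have [u' [U1' U2' Hu']] := common _ _ _ Aa' (or_intror Qq) Wl' ls'.
have [w [W1 W2 HA]] := chain_common avA (conA _ _ Aa Aa') Aa.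
have Aw : A w by apply: HA => //; apply: rt_refl.
have [p0 Pp0 Hp0] := HP _ Aw; have [q0 Qq0 Hq0] := HQ _ Aw.
have [p' [m [Pp' Um Wm Hp' Hm]]] := near_top avP conP Pp Pp0 Hp0 W1 U1 U2 Hu.
have [q' [m' [Qq' Um' Wm' Hq' Hm']]] := near_top avQ conQ Qq Qq0 Hq0 W2 U1' U2' Hu'.
have meet x y n : P x -> Q y -> above x n -> above y n ->
    height x + height y - 2 * height n < s -> False.
  move=> Px Qy /above_walk Wx /above_walk/walk_sym Wy Hn.
  by have := PQ _ _ _ Px Qy (walk_trans Wx Wy); lra.
have [le|le] := Rle_dec (height m) (height m').
  apply: (meet p' q' m) => //; last lra.
  exact: above_trans Um' (above_le Wm' Wm le).
apply: (meet p' q' m') => //; last lra.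
by apply: above_trans Um (above_le Wm Wm' _); lra.
Qed.

End Forest.

(** * Choosing one part per agent *)

Lemma separated_choice (F : {set gV G}) (s : R) (n r : nat)
    (P : 'I_n -> 'I_(n + r) -> pset G) :
  is_fvs F -> leq #|F| r -> 0 < s -> leq 1 n -> (forall i, s_separated s (P i)) ->
  exists c : 'I_n -> 'I_(n + r), s_separated s (fun i => P i (c i)).
Proof.
move=> HF Fr s0 n0 HP.
have [|o [H root]] := @fvs_rooted F (~: F) HF; first by move=> w; rewrite inE.
pose ok (x : 'I_n * 'I_(n + r)) := forall y f l,
  P x.1 x.2 y -> f \in F -> walk y (PV f) l -> s / 2 <= l.
pose J i := [set j | asbool (ok (i, j))].
have leJ i : leq n #|J i|.
  have := cardsC (J i); rewrite card_ord => E.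
  suff leC : leq #|~: J i| r by rewrite -(leq_add2r r); apply: leq_trans (eq_leq (esym E)) _; rewrite leq_add2l.
  apply: leq_trans Fr.
  pose near j f := exists y l, [/\ P i j y, walk y (PV f) l & l < s / 2].
  (* Parts near [F] inject into [F]: two of them within [s / 2] of the same [f] would be less than
     [s] apart. *)
  pose g j := [pick f in F | asbool (near j f)].
  have gP j : j \in ~: J i -> exists f, [/\ g j = Some f, f \in F & near j f].
    rewrite !inE => /asboolP Hn; rewrite /g; case: pickP => [f /andP[fF /asboolP]|Hno].
      by exists f.
    case: Hn => y f l Py fF W; apply: Rnot_lt_le => ls; have := Hno f.
    by rewrite fF /=; case: asboolP => // -[]; exists y, l.
  rewrite -(card_in_imset (f := g) (D := mem (~: J i))).
    rewrite -(card_imset (mem F) (@Some_inj _)); apply: subset_leq_card.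
    apply/subsetP => _ /imsetP[j /gP[f [-> fF _]] ->].
    by apply/imsetP; exists f.
  move=> j j' /gP[f [-> _ [y [l [Py W ls]]]]] /gP[f' [-> _ [y' [l' [Py' W' ls']]]]] [ff].
  rewrite -{}ff in W'; apply: NNPP => ne.
  have [_ /(_ j j' ne)[_ /(_ _ _ _ Py Py' (walk_trans W (walk_sym W')))]] := HP i; lra.
(* [R x y] holds when [x] reaches at least as high as [y], so an [R]-maximal pair has the deepest
   top. This form does not ask that a least height be attained, and it ranks empty parts as
   deepest. *)
pose R (x y : 'I_n * 'I_(n + r)) := forall a, P y.1 y.2 a ->
  exists2 p, P x.1 x.2 p & height o H p <= height o H a.
pose bad (x y : 'I_n * 'I_(n + r)) := ~ dist_ge (P x.1 x.2) (P y.1 y.2) s.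
have conP (x : 'I_n * 'I_(n + r)) : connected_piece (P x.1 x.2) by case: (HP x.1) => /(_ x.2)[].
have bad_sym (x y : 'I_n * 'I_(n + r)) : bad x y -> bad y x.
  by move=> Hb Hd; apply: Hb => a b l Pa Pb /walk_sym; apply: Hd.
have k0 : 'I_(n + r) by apply: (@Ordinal _ 0); rewrite ltn_addr.
have [|||||c [cJ cbad]] := @greedy_choice _ _ R bad ok k0 _ _ bad_sym _ [set: 'I_n] J.
- move=> x y; apply: NNPP => Hn; apply: (Hn); left => a Pa; apply: NNPP => Hn2.
  apply: (Hn); right => b Pb; exists a => //; apply: Rnot_lt_le => lt.
  by apply: Hn2; exists b => //; apply: Rlt_le.
- move=> x y z Rxy Ryz a /Ryz[b /Rxy[c Pc cb] ba]; exists c => //; lra.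
- move=> x i k k' okx oki oki' Rk Rk' bk bk'; apply: NNPP => ne.
  have near (y : 'I_n * 'I_(n + r)) : bad x y -> exists a p l, [/\ P x.1 x.2 a, P y.1 y.2 p, walk a p l & l < s].
    move=> Hb; apply: NNPP => Hn; apply: Hb => a p l Pa Pb W.
    by apply: Rnot_lt_le => ls; apply: Hn; exists a, p, l.
  have [a [p [l [Aa Pp W ls]]]] := near _ bk.
  have [a' [q [l' [Aa' Qq W' ls']]]] := near _ bk'.
  have [_ /(_ k k' ne)[_]] := HP i.
  apply: (at_most_one_near root s0 _ (conP x) (conP (i, k)) (conP (i, k')) Rk Rk'
    Aa Aa' Pp Qq W W' ls ls').
  by move=> y f m [|[|]] Py; [apply: okx|apply: oki|apply: oki'].
- by move=> i _; rewrite cardsT card_ord.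
- by move=> i k _; rewrite inE => /asboolP.
exists c; split=> [i|i i' ne]; first by case: (HP i) => /(_ (c i)).
have Hd : dist_ge (P i (c i)) (P i' (c i')) s.
  by apply: NNPP; apply: cbad; rewrite ?inE.
by split=> // x Px Px'; have := Hd x x 0 Px Px' (@walk_nil _ x); lra.
Qed.

(** * Canonical closed connected pieces *)

(* Either an interval of one edge, with
   ends [a (e, false)] and [a (e, true)], or a connected subgraph [(W, E)]
   together with a stub of length [a (e, b)] at every end [(e, b)] in [W]. *)
Definition shape : finType := (gE G + {set gV G} * {set gE G})%type.

Definition stub (a : gE G * bool -> R) (x : gE G * bool) : segdesc G :=
  if x.2 then Seg x.1 (glen x.1 - a x) (glen x.1) true true
  else Seg x.1 0 (a x) true true.

Definition shape_segs (sh : shape) (a : gE G * bool -> R) : seq (segdesc G) :=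
  match sh with
  | inl e => [:: Seg e (a (e, false)) (a (e, true)) true true]
  | inr WE => [seq Seg e 0 (glen e) true true | e <- enum WE.2] ++
      [seq stub a i | i <- enum [set i : gE G * bool | endv i.1 i.2 \in WE.1]]
  end.

Definition shape_verts (sh : shape) : seq (gV G) :=
  if sh is inr WE then enum WE.1 else [::].

Definition shape_set sh a : pset G := union_of (shape_segs sh a) (shape_verts sh).

Definition linked (E : {set gE G}) (u w : gV G) :=
  exists e b, [/\ e \in E, u = endv e b & w = endv e (~~ b)].

(** The range condition bounds every coordinate of [a]; together with the finiteness of [shape] this
    gives the compactness behind [shape_limit]. *)
Definition shape_ok (sh : shape) (a : gE G * bool -> R) : Prop :=
  (forall i, 0 <= a i <= glen i.1) /\
  match sh with
  | inl e => a (e, false) <= a (e, true)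
  | inr WE => (forall e b, e \in WE.2 -> endv e b \in WE.1) /\
      forall w w', w \in WE.1 -> w' \in WE.1 -> clos_refl_trans _ (linked WE.2) w w'
  end.

Lemma shape_set_interval e a x : shape_set (inl e) a x <->
  exists t, [/\ 0 <= t <= glen e, a (e, false) <= t <= a (e, true) & x = pt e t].
Proof.
rewrite /shape_set /union_of /=; split.
  by case=> [[d [[<-|//]]]|[? [//]]] [t /= [? [? [? ?]]]]; exists t.
move=> [t [? [? ?] ?]]; left; eexists; split; first by left.
by exists t.
Qed.

Lemma shape_set_subgraph W E a x : (forall i, 0 <= a i <= glen i.1) ->
  shape_set (inr (W, E)) a x <->
  [\/ exists2 w, w \in W & x = PV w,
      exists e d, [/\ e \in E, 0 <= d <= glen e & x = pe e false d] |
      exists e b d, [/\ endv e b \in W, 0 <= d <= a (e, b) & x = pe e b d]].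
Proof.
move=> Ha; rewrite /shape_set /union_of /=; split.
- case=> [[sd [/List.in_app_iff[/In_map_enum[e eE ->]|/In_map_enum[[e b]]]]]|[w [/In_mem]]].
  + by move=> [d /= [Hd [_ [_ ->]]]]; constructor 2; exists e, d.
  + rewrite inE /= => eW -> [t]; have := Ha (e, b); case: b eW => eW /= Hae [Ht [? [? ->]]].
      by constructor 3; exists e, true, (glen e - t); rewrite (pt_pe e true); split=> //; lra.
    by constructor 3; exists e, false, t; split=> //; lra.
  + by rewrite mem_enum; constructor 1; exists w.
- case=> [[w wW ->]|[e [d [eE Hd ->]]]|[e [b [d [eW Hd ->]]]]].
  + by right; exists w; split=> //; apply/In_mem; rewrite mem_enum.
  + left; exists (Seg e 0 (glen e) true true); split; last by exists d; repeat split=> //=; lra.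
    by apply/List.in_app_iff; left; apply/In_map_enum; exists e.
  + left; exists (stub a (e, b)); split.
      by apply/List.in_app_iff; right; apply/In_map_enum; exists (e, b); rewrite ?inE.
    have := Ha (e, b); case: b eW Hd => /= eW Hd Hae.
      by exists (glen e - d); rewrite /pe /=; split; [lra|split; [lra|split; [lra|]]].
    by exists d; rewrite /pe /=; split; [lra|split; [lra|split; [lra|]]].
Qed.

Lemma shape_set_piece sh a : is_piece (shape_set sh a).
Proof. by exists (shape_segs sh a), (shape_verts sh). Qed.

Lemma shape_set_connected sh a : shape_ok sh a -> connected_piece (shape_set sh a).
Proof.
case: sh => [e|[W E]] [Ha] /=.
  move=> le x y /shape_set_interval[t [Ht1 Ht2 ->]] /shape_set_interval[t' [Ht1' Ht2' ->]].
  apply: rt_step; exists e, t, t'; split=> // d Hd; apply/shape_set_interval; exists d.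
  by split=> //; move: Hd; rewrite /Rmin /Rmax; case: Rle_dec; lra.
move=> [endW conW] x y Dx Dy; pose D := shape_set (inr (W, E)) a.
(* Every point slides along its edge or stub to a vertex of [W]; vertices of [W] are then joined
   along edges of [E]. *)
have toV z : D z -> exists2 w, w \in W & clos_refl_trans _ (step_in D) z (PV w).
  move=> /(shape_set_subgraph _ _ _ Ha)[[w wW ->]|[e [d [eE Hd ->]]]|[e [b [d [eW Hd ->]]]]].
  - by exists w => //; apply: rt_refl.
  - exists (endv e false); first exact: endW.
    rewrite -pe0; apply/rt_step/step_in_pe => //; first by lra.
    move=> d' Hd'; apply/(shape_set_subgraph _ _ _ Ha); constructor 2; exists e, d'; split=> //.
    by move: Hd'; rewrite /Rmin /Rmax; case: Rle_dec; lra.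
  - exists (endv e b) => //; have /= Hae := Ha (e, b); rewrite -pe0.
    apply/rt_step/step_in_pe; [lra|lra|move=> d' Hd'].
    apply/(shape_set_subgraph _ _ _ Ha); constructor 3; exists e, b, d'; split=> //.
    by move: Hd'; rewrite /Rmin /Rmax; case: Rle_dec; lra.
have link u w : clos_refl_trans _ (linked E) u w -> clos_refl_trans _ (step_in D) (PV u) (PV w).
  elim=> [{}u {}w [e [b [eE -> ->]]]|{}u|{}u w' {}w _ H1 _ H2].
  - rewrite -pe0 -pe_len; have L := len_gt0 e; apply/rt_step/step_in_pe; [lra|lra|move=> d' Hd'].
    apply/(shape_set_subgraph _ _ _ Ha); constructor 2.
    exists e, (if b then glen e - d' else d'); split=> //.
    by move: Hd'; rewrite /Rmin /Rmax; case: Rle_dec; case: (b); lra.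
  - exact: rt_refl.
  - exact: rt_trans H1 H2.
have [w wW Hw] := toV _ Dx; have [w' wW' /chain_sym Hw'] := toV _ Dy.
exact: rt_trans Hw (rt_trans _ _ _ _ _ (link _ _ (conW _ _ wW wW')) Hw').
Qed.

(** Brings closeness of parameters into the form required by the continuity clause of
    [valuation]. *)
Lemma shape_segs_close sh a a' delta : 0 < delta ->
  (forall i, Rabs (a' i - a i) < delta) ->
  List.Forall2 (fun d d' => sg_e d' = sg_e d /\ sg_lc d' = sg_lc d /\
    sg_rc d' = sg_rc d /\ Rabs (sg_a d' - sg_a d) < delta /\
    Rabs (sg_b d' - sg_b d) < delta) (shape_segs sh a) (shape_segs sh a').
Proof.
move=> d0 Hd; have R0 t : Rabs (t - t) < delta by rewrite Rminus_diag Rabs_R0.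
case: sh => [e|[W E]] /=; first by constructor; [repeat split; apply: Hd|constructor].
apply: List.Forall2_app.
  by elim: (enum E) => [|i t IH] /=; constructor=> //; repeat split; apply: R0.
elim: (enum _) => [|i t IH] /=; constructor=> //.
rewrite /stub; case: i => e [] /=; repeat split; try exact: R0; last exact: Hd.
by rewrite -Rabs_Ropp; have := Hd (e, true); congr (_ < _); congr Rabs; ring.
Qed.

(** Vertices and full edges stay put; a point of the interval or of a stub is clamped to the new
    one. *)
Lemma shape_set_close sh a a' x eps : shape_ok sh a -> shape_ok sh a' -> 0 < eps ->
  (forall i, Rabs (a' i - a i) < eps) -> shape_set sh a x ->
  exists y l, [/\ shape_set sh a' y, walk y x l & l < eps].
Proof.
case: sh => [e|[W E]] [Ha Hok] [Ha' Hok'] e0 close.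
  move=> /shape_set_interval[t [Ht Hat ->]].
  have [t' [Ht' near]] := clamp_close Hok' Hat (close _) (close _).
  have /= ? := Ha' (e, false); have /= ? := Ha' (e, true).
  exists (pt e t'), (Rabs (t - t')); split=> //.
    by apply/shape_set_interval; exists t'; split=> //; lra.
  by apply: (@walk_edge _ _ e); split; [lra|split; [lra|]].
move=> /(shape_set_subgraph _ _ _ Ha)[[w wW ->]|[e [d [eE Hd ->]]]|[e [b [d [eW Hd ->]]]]].
- exists (PV w), 0; split=> //; last exact: walk_nil.
  by apply/(shape_set_subgraph _ _ _ Ha'); constructor 1; exists w.
- exists (pe e false d), 0; split=> //; last exact: walk_nil.
  by apply/(shape_set_subgraph _ _ _ Ha'); constructor 2; exists e, d.
- have [|d' [Hd' near]] := clamp_close (proj1 (Ha' (e, b))) Hd _ (close (e, b)).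
    by rewrite Rminus_diag Rabs_R0.
  have /= ? := Ha' (e, b); have /= ? := Ha (e, b).
  exists (pe e b d'), (Rabs (d - d')); split=> //.
    by apply/(shape_set_subgraph _ _ _ Ha'); constructor 3; exists e, b, d'.
  by apply: walk_pe; lra.
Qed.

(** * Covering a connected piece by a canonical one *)

Lemma piece_point X x : is_piece X -> X x ->
  (exists e t, 0 <= t <= glen e /\ x = pt e t) \/ exists w, x = PV w.
Proof.
move=> [ds [vs HX]] /HX[[d [_ [t [Ht [_ [_ ->]]]]]]|[w [_ ->]]]; last by right; exists w.
by left; exists (sg_e d), t.
Qed.

Definition within X x eps := exists y l, [/\ X y, walk y x l & l < eps].

(** Without vertices, [X] cannot leave the interior of the edge of [x0]; the ends of the cover are
    the farthest extents of [X] from [x0] in the two directions. *)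
Lemma interval_cover X x0 : is_piece X -> connected_piece X ->
  (forall w, ~ X (PV w)) -> X x0 -> exists sh a, [/\ shape_ok sh a,
    forall x, X x -> shape_set sh a x &
    forall x eps, 0 < eps -> shape_set sh a x -> within X x eps].
Proof.
move=> pieceX conX noV Xx0; have [[e [t0 [Ht0 Ex0]]]|[w E]] := piece_point pieceX Xx0; last first.
  by case: (noV w); rewrite -E.
have interior e' d : 0 <= d <= glen e' -> X (pe e' false d) -> 0 < d < glen e'.
  move=> /(pe_cases false)[->|->|//].
  - by rewrite pe0 => /noV.
  - by rewrite pe_len => /noV.
have Ht0' : 0 < t0 < glen e by apply: interior => //; rewrite /pe -Ex0.
have [|//|a1 [Ha1 max1 near1]] := @initial_segment_sup (fun d => X (pt e (t0 + d))) (glen e - t0).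
  by lra.
  by rewrite Rplus_0_r -Ex0.
have [|//|a2 [Ha2 max2 near2]] := @initial_segment_sup (fun d => X (pt e (t0 - d))) t0.
  by lra.
  by rewrite Rminus_0_r -Ex0.
pose a (i : gE G * bool) := if i.1 == e then (if i.2 then t0 + a1 else t0 - a2) else 0.
have [af at'] : a (e, false) = t0 - a2 /\ a (e, true) = t0 + a1 by rewrite /a eqxx.
exists (inl e), a; split.
- split=> [[e' b]|]; last by rewrite af at'; lra.
  rewrite /a /=; case: eqP => [->|_]; last by have := len_gt0 e'; lra.
  by case: b; lra.
(* Invariant along a chain of moves from [x0]: the whole segment of [e] from [x0] to the current
   point lies in [X]. *)
- move=> x Xx; pose Inv y := exists t, [/\ 0 < t < glen e, y = pe e false t &
    forall t', t0 <= t' <= t \/ t <= t' <= t0 -> X (pe e false t')].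
  have [t [Ht -> Hall]] : Inv x.
    have := conX _ _ Xx0 Xx => /clos_rt_rtn1_iff; elim=> [|y z Hs _ [t [Ht Ey Hall]]].
      exists t0; split=> // t' Ht'; have -> : t' = t0 by lra.
      by rewrite /pe -Ex0.
    have [e' [d1 [d2 [H1 H2 Ey' Ez HX]]]] := step_in_peE Hs false.
    have [Ee /(_ erefl) Ed] := pe_interior Ht H1 (etrans (esym Ey) Ey'); subst e' d1.
    have HX' d : t <= d <= d2 \/ d2 <= d <= t -> X (pe e false d).
      by move=> Hd; apply: HX; rewrite /Rmin /Rmax; case: Rle_dec; lra.
    exists d2; split=> //; first by apply: interior => //; apply: HX'; lra.
    move=> t' Ht'; have [?|?] : (t0 <= t' <= t \/ t <= t' <= t0) \/ (t <= t' <= d2 \/ d2 <= t' <= t) by lra.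
      exact: Hall.
    exact: HX'.
  apply/shape_set_interval; exists t; split=> //; first by lra.
  rewrite af at'; have [le|le] := Rle_dec t0 t.
    have : t - t0 <= a1 by apply: max1 => [|d ?]; [lra|apply: Hall; lra].
    by lra.
  have : t0 - t <= a2 by apply: max2 => [|d ?]; [lra|apply: Hall; lra].
  by lra.
- move=> x eps e0 /shape_set_interval[t [Ht]]; rewrite af at' => Hat ->.
  have [le|le] := Rle_dec t0 t.
    have [|d' [Hd' Hlt HX]] := near1 (t - t0) eps e0; first lra.
    exists (pt e (t0 + d')), (Rabs (t - (t0 + d'))); split=> //.
      by apply: (@walk_pe e false); lra.
    by rewrite Rabs_right; lra.
  have [|d' [Hd' Hlt HX]] := near2 (t0 - t) eps e0; first lra.
  exists (pt e (t0 - d')), (Rabs (t - (t0 - d'))); split=> //.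
    by apply: (@walk_pe e false); lra.
  by rewrite Rabs_left1; lra.
Qed.

(** [W] collects the vertices of [X], [E] the edges contained in [X], and each stub is the longest
    initial segment in [X], closed up. *)
Lemma subgraph_cover X w0 : connected_piece X -> X (PV w0) ->
  exists sh a, [/\ shape_ok sh a, forall x, X x -> shape_set sh a x &
    forall x eps, 0 < eps -> shape_set sh a x -> within X x eps].
Proof.
move=> conX Xw0.
pose W := [set w | asbool (X (PV w))].
have WP w : w \in W <-> X (PV w) by rewrite inE; split=> /asboolP.
pose E := [set e | asbool (forall d, 0 <= d <= glen e -> X (pe e false d))].
have EP e b : e \in E <-> forall d, 0 <= d <= glen e -> X (pe e b d).
  rewrite inE; split=> [/asboolP HX d Hd|HX].
    by case: b; rewrite ?(pe_flip e true); apply: HX; lra.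
  by apply/asboolP => d Hd; case: b HX => HX; rewrite ?(pe_flip e false); apply: HX; lra.
pose is_stub (i : gE G * bool) (r : R) := 0 <= r <= glen i.1 /\
    (endv i.1 i.2 \in W ->
     (forall d, 0 <= d <= glen i.1 -> (forall d', 0 <= d' <= d -> X (pe i.1 i.2 d')) -> d <= r) /\
     (forall d eps, 0 < eps -> 0 <= d <= r ->
        exists d', [/\ 0 <= d' <= d, d - d' < eps & X (pe i.1 i.2 d')])).
have [a Ha] : exists a, forall i, is_stub i (a i).
  apply: choice_fun => -[e b]; rewrite /is_stub /=; have ? := len_gt0 e.
  have [/WP Hw|] := boolP (endv e b \in W); last by exists 0; split=> //; lra.
  have [||r [? ? ?]] := @initial_segment_sup (fun d => X (pe e b d)) (glen e).
  - by lra.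
  - by rewrite pe0.
  by exists r.
have a_range i : 0 <= a i <= glen i.1 by case: (Ha i).
pose C w := clos_refl_trans _ (linked E) w0 w.
(* Invariant along a chain from [w0]: the current point is a vertex linked to [w0], or is joined
   inside [X] to such a vertex along one edge. By [norm], reaching the far end of an edge puts it
   into [E]. *)
pose Inv x := (exists2 w, C w & x = PV w) \/ (exists e b d, [/\ 0 < d < glen e,
  x = pe e b d, C (endv e b) & forall d', 0 <= d' <= d -> X (pe e b d')]).
have norm e b d : 0 <= d <= glen e -> C (endv e b) ->
    (forall d', 0 <= d' <= d -> X (pe e b d')) -> Inv (pe e b d).
  move=> Hd Ce HX; case: (pe_cases b Hd) => [Ed|Ed|Hm].
  - by left; exists (endv e b) => //; rewrite Ed pe0.
  - left; exists (endv e (~~ b)); last by rewrite Ed pe_len.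
    apply: rt_trans Ce _; apply: rt_step; exists e, b; split=> //.
    by apply/(EP e b) => d' Hd'; apply: HX; rewrite Ed.
  - by right; exists e, b, d.
have InvX x : X x -> Inv x.
  move=> Xx; have := conX _ _ Xw0 Xx => /clos_rt_rtn1_iff; elim=> [|y z Hs _].
    by left; exists w0 => //; apply: rt_refl.
  case=> [[w Cw Ey]|[e [b [d [Hd Ey Ce HX]]]]].
    have [e [d1 [d2 [H1 H2 Ey1 -> HX]]]] := step_in_peE Hs false.
    have [[E1 Ew]|[E1 Ew]] := pe_vertex H1 (etrans (esym Ey1) Ey).
      apply: norm => //; first by rewrite -Ew.
      by move=> d' Hd'; apply: HX; rewrite /Rmin /Rmax; case: Rle_dec; lra.
    rewrite pe_flip; apply: norm; [lra|by rewrite -Ew|move=> d' Hd'].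
    by rewrite pe_flip; apply: HX; rewrite /Rmin /Rmax; case: Rle_dec; lra.
  have [e' [d1 [d2 [H1 H2 Ey1 -> HX']]]] := step_in_peE Hs b.
  have [Ee /(_ erefl) Ed] := pe_interior Hd H1 (etrans (esym Ey) Ey1); subst e' d1.
  apply: norm => // d' Hd'; have [?|?] := Rle_dec d' d; first by apply: HX; lra.
  by apply: HX'; rewrite /Rmin /Rmax; case: Rle_dec; lra.
have WC w : w \in W -> C w.
  move=> /WP/InvX[[w' Cw [->]] //|[e [b [d [Hd E' _ _]]]]].
  by rewrite pe_mid in E'.
have CW w : C w -> w \in W.
  move=> /clos_rt_rtn1_iff; elim=> [|w1 w2 [e [b [eE _ ->]]] _ _]; first exact/WP.
  by apply/WP; rewrite -pe_len; apply: (proj1 (EP e b) eE); have := len_gt0 e; lra.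
have link_sym u w : linked E u w -> linked E w u.
  by case=> e [b [eE -> ->]]; exists e, (~~ b); rewrite negbK.
have path_sym u w : clos_refl_trans _ (linked E) u w -> clos_refl_trans _ (linked E) w u.
  elim=> [? ? /link_sym|?|? ? ? _ H1 _ H2]; [exact: rt_step|exact: rt_refl|exact: rt_trans H2 H1].
exists (inr (W, E)), a; split.
- split=> //; split=> [e b /(EP e b) HX|w w' /WC Cw /WC Cw'].
    by apply/WP; rewrite -pe0; apply: HX; have := len_gt0 e; lra.
  by apply: rt_trans Cw'; apply: path_sym.
- move=> x Xx; apply/(shape_set_subgraph _ _ _ a_range).
  have [[w Cw ->]|[e [b [d [Hd -> Ce HX]]]]] := InvX _ Xx.
    by constructor 1; exists w => //; apply: CW.
  constructor 3; exists e, b, d; have eW := CW _ Ce; split=> //.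
  have [_ /(_ eW)[max _]] := Ha (e, b).
  by split; [lra|apply: max => //=; lra].
- move=> x eps e0 /(shape_set_subgraph _ _ _ a_range)[[w /WP Xw ->]|[e [d [/(EP e false) HX Hd ->]]]|].
  + by exists (PV w), 0; split=> //; apply: walk_nil.
  + by exists (pe e false d), 0; split=> //; [apply: HX|apply: walk_nil].
  move=> [e [b [d [eW Hd ->]]]]; have [/= Hae /(_ eW)[_ near]] := Ha (e, b).
  have [d' [Hd' Hlt /= HX]] := near _ _ e0 Hd.
  exists (pe e b d'), (Rabs (d - d')); split=> //; first by apply: walk_pe; lra.
  by rewrite Rabs_right; lra.
Qed.

(** The cover lies between [X] and its closure: by monotonicity no value is lost, and distances
    between pieces do not shrink. An empty [X] is covered by the empty subgraph. *)
Lemma shape_cover X : is_piece X -> connected_piece X ->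
  exists sh a, [/\ shape_ok sh a, forall x, X x -> shape_set sh a x &
    forall x eps, 0 < eps -> shape_set sh a x -> within X x eps].
Proof.
move=> pieceX conX.
have [[w0 Xw0]|noV] := classic (exists w, X (PV w)); first exact: subgraph_cover Xw0.
have [[x0 Xx0]|noX] := classic (exists x, X x).
  by apply: interval_cover Xx0 => // w Xw; apply: noV; exists w.
have a_range (i : gE G * bool) : 0 <= 0 <= glen i.1 by have := len_gt0 i.1; lra.
exists (inr (set0, set0)), (fun=> 0); split.
- by split=> //; split=> [e b|w w']; rewrite inE.
- by move=> x Xx; case: noX; exists x.
- move=> x eps _ /(shape_set_subgraph _ _ _ a_range)[[w]|[e [d []]]|[e [b [d []]]]];
  by rewrite inE.
Qed.

(** * Existence of a maximin partition *)

Lemma shape_limit (k : nat) (sh : nat -> 'I_k -> shape) (a : nat -> 'I_k -> gE G * bool -> R) :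
  (forall n j, shape_ok (sh n j) (a n j)) ->
  exists sigma l, forall delta N, 0 < delta -> exists2 m, leq N m &
    forall j, sh m j = sigma j /\ forall i, Rabs (a m j i - l j i) < delta.
Proof.
move=> Hok.
(* The shapes are encoded by integers: integers close to a common limit agree. *)
pose u n (c : 'I_k * option (gE G * bool)) :=
  if c.2 is Some i then a n c.1 i else INR (enum_rank (sh n c.1)).
pose B (c : 'I_k * option (gE G * bool)) :=
  if c.2 is Some i then glen i.1 else INR #|shape|.
have HB n c : Rabs (u n c) <= B c.
  case: c => j [i|]; rewrite /u /B /=.
    by case: (Hok n j) => /(_ i) ? _; rewrite Rabs_right; lra.
  rewrite Rabs_right; last by apply/Rle_ge/pos_INR.
  by apply: le_INR; apply/leP; apply: ltnW; apply: ltn_ord.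
have [l Hl] := cluster_point (enum {: 'I_k * option (gE G * bool)}) HB.
have [|m0 _ Hm0] := Hl (1 / 2) O; first lra.
exists (sh m0), (fun j i => l (j, Some i)) => delta N d0.
(* With precision [1 / 2] at [m] and at [m0], the two codes of a shape differ by less than 1. *)
have [|m Nm Hm] := Hl (Rmin delta (1 / 2)) N; first by apply: Rmin_pos; lra.
have mem c : c \in enum {: 'I_k * option (gE G * bool)} by rewrite mem_enum.
have ? := Rmin_l delta (1 / 2); have ? := Rmin_r delta (1 / 2).
exists m => // j; split=> [|i]; last by have := Hm _ (mem (j, Some i)); rewrite /u /=; lra.
apply: enum_rank_inj; apply: val_inj.
have /Rabs_def2 := Hm _ (mem (j, None)); have /Rabs_def2 := Hm0 _ (mem (j, None)).
by rewrite /u /= => ? ?; apply: INR_close_eq; lra.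
Qed.

(** Cover the parts of nearly optimal partitions canonically and pass to a limit of the covers:
    separation survives because it is a closed condition, values by continuity. *)
Lemma mms_attained (v : pset G -> R) (k : nat) (s : R) : valuation v -> 0 < s -> leq 1 k ->
  exists2 P : 'I_k -> pset G, s_separated s P & forall j, ge_MMS v k s (v (P j)).
Proof.
move=> [v_ge0 [v_mono [_ v_cont]]] s0 k0.
pose E r := exists2 Q : 'I_k -> pset G, s_separated s Q & forall j, r <= v (Q j).
(* The whole cake, connected or not, bounds all values; the partition into empty parts shows that
   [E] is inhabited. *)
pose full := shape_set (inr (setT, setT)) (fun=> 0).
have a_range (i : gE G * bool) : 0 <= 0 <= glen i.1 by have := len_gt0 i.1; lra.
have v_full X : is_piece X -> v X <= v full.
  move=> pieceX; apply: v_mono => // [|x Xx]; first exact: shape_set_piece.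
  apply/(shape_set_subgraph _ _ _ a_range).
  have [[e [t [Ht ->]]]|[w ->]] := piece_point pieceX Xx.
    by constructor 2; exists e, t; rewrite inE.
  by constructor 1; exists w; rewrite ?inE.
have [||M [ubM lubM]] := completeness E.
- exists (v full) => r [Q [HQ _] /(_ (Ordinal k0))/Rle_trans]; apply.
  by apply: v_full; case: (HQ (Ordinal k0)).
- have piece0 : is_piece (fun _ : point G => False).
    by exists [::], [::] => x; split=> // -[[? []]|[? []]].
  exists 0, (fun _ _ => False) => [|j]; last exact: v_ge0.
  by split=> [j|i j _]; split=> // x.
have approx n : exists Q : 'I_k -> pset G, s_separated s Q /\ forall j, M - / INR n.+1 <= v (Q j).
  have n0 : 0 < / INR n.+1 by apply: Rinv_0_lt_compat; apply: lt_0_INR; apply/ltP.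
  apply: NNPP => Hn; suff : M <= M - / INR n.+1 by lra.
  apply: lubM => r [Q HQ Hr]; apply: Rnot_lt_le => lt; apply: Hn; exists Q.
  by split=> // j; have := Hr j; lra.
have {approx}[Q HQ] := choice_fun approx.
pose cover (nj : nat * 'I_k) (c : shape * (gE G * bool -> R)) :=
  [/\ shape_ok c.1 c.2, forall x, Q nj.1 nj.2 x -> shape_set c.1 c.2 x &
    forall x eps, 0 < eps -> shape_set c.1 c.2 x -> within (Q nj.1 nj.2) x eps].
have [c Hc] : exists c, forall nj, cover nj (c nj).
  apply: choice_fun => -[n j]; case: (HQ n) => -[/(_ j)[pQ cQ] _] _.
  by have [sh [a [? ? ?]]] := shape_cover pQ cQ; exists (sh, a).
have [sigma [l lim]] := @shape_limit k (fun n j => (c (n, j)).1) (fun n j => (c (n, j)).2)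
  (fun n j => let: And3 H _ _ := Hc (n, j) in H).
(* The conditions on the parameters are weak inequalities, so they pass to the limit. *)
have okP j : shape_ok (sigma j) (l j).
  have close i eps : 0 < eps -> exists r, [/\ 0 <= r <= glen i.1, Rabs (r - l j i) < eps &
      forall e, sigma j = inl e -> i = (e, false) ->
        exists r', r <= r' /\ Rabs (r' - l j (e, true)) < eps].
    move=> e0; have [m _ /(_ j)[Esh Hm]] := lim eps O e0.
    have [[Ha Hs] _ _] := Hc (m, j); exists ((c (m, j)).2 i); split=> // e Ee Ei.
    exists ((c (m, j)).2 (e, true)); split=> //.
    by move: Hs; rewrite Esh Ee Ei.
  have [m _ /(_ j)[Esh _]] := lim 1 O Rlt_0_1.
  have [[_ Hs] _ _] := Hc (m, j); rewrite /= Esh in Hs; split=> [i|].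
    split; apply: Rnot_lt_le => lt.
      by have [|r [? /Rabs_def2 ? _]] := close i (- l j i); lra.
    by have [|r [? /Rabs_def2 ? _]] := close i (l j i - glen i.1); lra.
  case Es: (sigma j) Hs => [e|//] _; apply: Rnot_lt_le => lt.
  have [|r [_ /Rabs_def2 ? /(_ e Es erefl)[r' [? /Rabs_def2 ?]]]] :=
    close (e, false) ((l j (e, false) - l j (e, true)) / 2); lra.
pose P j := shape_set (sigma j) (l j).
(* One [eps] leads from the limit to the cover, the other from the cover to [Q]. *)
have nearQ eps N : 0 < eps -> exists2 m, leq N m & forall j x, P j x -> within (Q m j) x (2 * eps).
  move=> e0; have [m Nm Hm] := lim eps N e0; exists m => // j x Px.
  have [Esh Hclose] := Hm j; have [okc _ nearc] := Hc (m, j); rewrite /= Esh in okc nearc.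
  have [y [d [Dy Wy lty]]] := shape_set_close (okP j) okc e0 Hclose Px.
  have [z [d' [Qz Wz ltz]]] := nearc _ _ e0 Dy.
  by exists z, (d' + d); split=> //; [apply: walk_trans Wz Wy|lra].
have sepP : s_separated s P.
  have dist i j : i <> j -> dist_ge (P i) (P j) s.
    move=> ne x y d Px Py W; apply: Rnot_lt_le => lt.
    (* The detour at each end is below [2 * (s - d) / 5], so the joint walk stays below
       [d + 4 * (s - d) / 5 < s]. *)
    have [|m _ near] := nearQ ((s - d) / 5) O; first lra.
    have [x' [d1 [Qx W1 lt1]]] := near _ _ Px; have [y' [d2 [Qy W2 lt2]]] := near _ _ Py.
    have [[_ /(_ i j ne)[_ /(_ _ _ _ Qx Qy (walk_trans W1 (walk_trans W (walk_sym W2)))) le]] _] := HQ m.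
    by lra.
  split=> [j|i j ne].
    by split; [apply: shape_set_piece|apply: shape_set_connected].
  split=> [x Pix Pjx|]; last exact: dist.
  by have := dist i j ne x x 0 Pix Pjx (@walk_nil _ x); lra.
exists P => // j Q' HQ'.
have MP : M <= v (P j).
  (* One half of the gap absorbs the error of continuity, the other the defect [/ INR m.+1]. *)
  apply: Rnot_lt_le => lt; pose eps := (M - v (P j)) / 2.
  have e0 : 0 < eps by rewrite /eps; lra.
  have [delta [d0 cont]] := v_cont (shape_segs (sigma j) (l j)) (shape_verts (sigma j)) _ e0.
  have [N [_ HN]] := inv_INR_lt O e0.
  have [m Nm /(_ j)[Esh Hm]] := lim delta N d0.
  have /Rabs_def2 Hv := cont _ (shape_segs_close _ d0 Hm).
  have [okc sub _] := Hc (m, j); have [sepQ /(_ j) MQ] := HQ m.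
  have : v (Q m j) <= v (shape_set (sigma j) (c (m, j)).2).
    apply: v_mono => [||x /sub]; rewrite ?Esh //; last exact: shape_set_piece.
    by case: sepQ => /(_ j)[].
  rewrite /shape_set; have := HN m Nm; rewrite /eps /P /shape_set in Hv *; lra.
(* The order is reversed, so [i] is a part of least value. *)
have [|||i _ Hi] := @total_max _ (fun i i' => v (Q' i') <= v (Q' i)) (enum 'I_k).
- by move=> i i'; lra.
- by move=> i1 i2 i3; lra.
- by move=> E0; have := mem_enum 'I_k (Ordinal k0); rewrite E0.
exists i; apply: Rle_trans MP; apply: ubM; exists Q' => // i'.
by apply: Hi; rewrite mem_enum.
Qed.

End Graph.

(** * Assembling the allocation *)

Theorem theorem4 (G : mgraph) (s : R) (r n : nat)
  (v : 'I_n -> pset G -> R) :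
  wf_graph G ->
  (0 < s)%R ->
  (forall e : gE G, (s <= glen e)%R) ->
  FvsNum_is G r ->
  leq 1 n ->
  (forall i, valuation (v i)) ->
  exists A : 'I_n -> pset G,
    s_separated s A /\
    forall i, ge_MMS (v i) (n + r) s (v i (A i)).
Proof.
move=> wfG s0 _ [[F [HF Er]] _] n0 Hv; have Fr := eq_leq Er.
have k0 : leq 1 (n + r) by rewrite ltn_addr.
have best i := mms_attained wfG (Hv i) s0 k0.
pose optimal i (P : 'I_(n + r) -> pset G) := s_separated s P /\
  forall j, ge_MMS (v i) (n + r) s (v i (P j)).
have [P HP] : exists P, forall i, optimal i (P i).
  by apply: choice_fun => i; case: (best i) => P; exists P.
have [c Hc] := separated_choice wfG HF Fr s0 n0 (fun i => proj1 (HP i)).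
by exists (fun i => P i (c i)); split=> // i; case: (HP i) => _; apply.
Qed.
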